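(* Let $\mathbb{X}$ and $\mathbb{Y}$ be finite-dimensional (real) polyhedral Banach spaces and let $\dim(\mathbb{X})=n$. Let $T\in\mathbb{L}(\mathbb{X},\mathbb{Y})$ with $\|T\|=1$. Then $T$ is an extreme contraction if and only if exactly one of the following conditions holds: (i) The extremal number of $T$ is equal to $n$. (ii) The extremal number of $T$ is strictly less than $n$, and there exist $v\in M_T\cap Ext(B_{\mathbb{X}})$ and a basis $S\subset S_{\mathbb{X}}$ of $\mathbb{X}$ containing $v$ such that $Tv\notin Ext(B_{\mathbb{Y}})$ and $(v,Tv)$ is a $*$-pair of points with respect to $S$ (for the operator $T$).
   Context: All Banach spaces are real. $B_{\mathbb{X}}=\{x\in\mathbb{X}:\|x\|\le 1\}$ and $S_{\mathbb{X}}=\{x\in\mathbb{X}:\|x\|=1\}$ denote the unit ball and unit sphere; $Ext(A)$ is the set of extreme points of a non-empty convex set $A$; $\mathbb{L}(\mathbb{X},\mathbb{Y})$ is the space of bounded linear operators from $\mathbb{X}$ to $\mathbb{Y}$ with the operator norm; an extreme contraction is an extreme point of $B_{\mathbb{L}(\mathbb{X},\mathbb{Y})}$; $M_T=\{x\in S_{\mathbb{X}}:\|Tx\|=\|T\|\}$; $\theta$ is the zero vector; $\mathcal{B}(x,\epsilon)$ is the open ball with center $x$ and radius $\epsilon$. A finite-dimensional Banach space $\mathbb{X}$ is polyhedral if $Ext(B_{\mathbb{X}})$ is finite; in other words, $B_{\mathbb{X}}$ is a polyhedron in $\mathbb{R}^n$ for some natural number $n\ge 2$. Faces. A polyhedron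 $P$ is a non-empty compact set that is the intersection of finitely many closed half-spaces; its dimension is the dimension of the subspace generated by the differences $v-w$, $v,w\in P$. A polyhedron $Q$ is a face of $P$ if either $Q=P$ or $Q=P\cap\delta M$, where $M$ is a closed half-space containing $P$ and $\delta M$ is its boundary; a face of dimension $i$ is called an $i$-face. For $v\in S_{\mathbb{X}}$, if $F$ is an $i$-face of $B_{\mathbb{X}}$ containing $v$ such that no $(i-1)$-face of $B_{\mathbb{X}}$ contains $v$, then $F$ is called the minimal face of $v$ (it is always unique). Extremal number. Let $T\in S_{\mathbb{L}(\mathbb{X},\mathbb{Y})}$. If $S$ is a maximal (with respect to inclusion) linearly independent subset of $M_T\cap Ext(B_{\mathbb{X}})$ such that $T(S)\subset Ext(B_{\mathbb{Y}})$, then the cardinality of $S$ (which does not depend on the choice of $S$) is the extremal number of $T$. Associated tuples. Let $v\in S_{\mathbb{X}}$ have minimal face $F$ with $Ext(B_{\mathbb{X}})\cap F=\{w_1,\ldots,w_r\}$, and let $\epsilon>0$. An $r$-tuple of scalars $(\mu_1,\ldots,\mu_r)$ is an $F$-associated tuple of scalars corresponding to $v$ with $\epsilon$-dominated norm if $v+\sum_{i=1}^r\mu_iw_i\in F$, $v-\sum_{i=1}^r\mu_iw_i\in F$ and $\|\sum_{i=1}^r\mu_iw_i\|<\epsilon$. (The same definition is used in $\mathbb{Y}$.) Diametric points. For $x\in B_{\mathbb{X}}$ and $\epsilon>0$, a pair $u,v\in\mathbb{X}$ is a pair of $\epsilon$-diametric points of $x$ if $u,v\in\mathcal{B}(x,\epsilon)\cap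 B_{\mathbb{X}}$ and $u+v=2x$. (The same definition is used in $\mathbb{Y}$.) $*$-pair. Let $T\in S_{\mathbb{L}(\mathbb{X},\mathbb{Y})}$, $\dim(\mathbb{X})=n$, $(x,y)\in S_{\mathbb{X}}\times S_{\mathbb{Y}}$, let $F$ be the minimal face of $y$ with $Ext(B_{\mathbb{Y}})\cap F=\{w_1,\ldots,w_r\}$, and let $S=\{x,z_2,\ldots,z_n\}\subset S_{\mathbb{X}}$ be linearly independent. Then $(x,y)$ is a $*$-pair of points with respect to $S$ if, given any $\epsilon>0$ and any pair of $\epsilon$-diametric points $u_i,v_i$ of $Tz_i$, where $2\le i\le n$, there exists $\widetilde{v}=\alpha_1x+\sum_{i=2}^n\alpha_iz_i\in Ext(B_{\mathbb{X}})$ such that the following condition holds: $$\Big\|\alpha_1y+\sum_{i=2}^n\alpha_iu_i+\alpha_1\Big(\sum_{j=1}^r\mu_jw_j\Big)\Big\|>1\quad\text{or}\quad\Big\|\alpha_1y+\sum_{i=2}^n\alpha_iv_i-\alpha_1\Big(\sum_{j=1}^r\mu_jw_j\Big)\Big\|>1,$$ for any $F$-associated tuple of scalars $(\mu_1,\ldots,\mu_r)$ corresponding to $y$ with $\epsilon$-dominated norm, where $\alpha_1\big(\sum_{j=1}^r\mu_jw_j\big)\neq\theta$ whenever $(u_2,u_3,\ldots,u_n)=(v_2,v_3,\ldots,v_n)$.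
   Formalization: In the definition of *-pair, the extreme point ṽ may depend on the associated tuple μ; when all u_i=v_i, only tuples with Σμ_jw_j≠θ are considered and ṽ must satisfy α_1Σμ_jw_j≠θ. With ṽ chosen before μ, as printed, the theorem is false. *)

(* Defs.v *)
From HB Require Import structures.
From mathcomp Require Import all_boot all_order all_algebra.
From mathcomp Require Import all_classical all_reals all_analysis.
Set Implicit Arguments.
Unset Strict Implicit.
Unset Printing Implicit Defensive.
Import Order.TTheory GRing.Theory Num.Theory.
Import numFieldNormedType.Exports.
Local Open Scope classical_set_scope.
Local Open Scope ring_scope.

(* Every linear map between these spaces is bounded, so that 'Hom(X, Y) is    *)
(* the space of bounded linear operators.                                     *)
#[short(type="finBanachType")]
HB.structure Definition FinBanach (R : numFieldType) :=
  {V of CompleteNormedModule R V & Vector R V}.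

Definition exactly_one (P Q : Prop) : Prop := (P /\ ~ Q) \/ (~ P /\ Q).

Definition extreme_points (R : realType) (V : lmodType R) (A : set V) : set V :=
  [set x | A x /\ forall (u v : V) (t : R), A u -> A v -> 0 < t < 1 ->
                    x = t *: u + (1 - t) *: v -> u = x /\ v = x].

Definition unit_ball (R : realType) (V : finBanachType R) : set V :=
  [set x | `|x| <= 1].
Arguments unit_ball {R} V _.

Definition unit_sphere (R : realType) (V : finBanachType R) : set V :=
  [set x | `|x| = 1].
Arguments unit_sphere {R} V _.

Section Geometry.
Context {R : realType}.
Implicit Types V : finBanachType R.

Definition polyhedral V : Prop := finite_set (extreme_points (unit_ball V)).

Definition closed_halfspace V (f : 'Hom(V, R^o)) (c : R) : set V :=
  [set x | f x <= c].

(* The boundary of [closed_halfspace f c] when f is not zero. *)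
Definition halfspace_boundary V (f : 'Hom(V, R^o)) (c : R) : set V :=
  [set x | f x = c].

Definition polyhedron V (P : set V) : Prop :=
  [/\ P !=set0, compact P &
      exists s : seq ('Hom(V, R^o) * R),
        (forall h, h \in s -> h.1 != 0) /\
        P = [set x | forall h, h \in s -> closed_halfspace h.1 h.2 x]].

Definition face V (P Q : set V) : Prop :=
  polyhedron Q /\
  (Q = P \/ exists (f : 'Hom(V, R^o)) (c : R),
     [/\ f != 0, P `<=` closed_halfspace f c &
         Q = P `&` halfspace_boundary f c]).

Definition is_lin_span V (A : set V) (U : {vspace V}) : Prop :=
  (forall x, A x -> x \in U) /\
  (forall W : {vspace V}, (forall x, A x -> x \in W) -> (U <= W)%VS).

Definition lin_span V (A : set V) : {vspace V} :=
  xget 0%VS [set U | is_lin_span A U].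

Lemma lin_spanP V (A : set V) : is_lin_span A (lin_span A).
Proof.
rewrite /lin_span; case: xgetP => [U _ //|noU]; exfalso.
pose p (k : nat) := `[<exists U : {vspace V},
  (forall x, A x -> x \in U) /\ \dim U = k>].
have exp : exists k, p k.
  exists (\dim {:V}); apply/asboolP; exists fullv; split=> // x _.
  exact: memvf.
case: (ex_minnP exp) => k /asboolP[U [AU dU]] kmin.
apply: (noU U); split=> // W AW.
have : (k <= \dim (U :&: W))%N.
  apply: kmin; apply/asboolP; exists (U :&: W)%VS; split=> // x Ax.
  by rewrite memv_cap AU ?AW.
move=> kUW; have /eqP : (U :&: W == U)%VS by rewrite eqEdim capvSl dU.
by move=> <-; exact: capvSr.
Qed.

Definition polyhedron_dim V (P : set V) : nat :=
  \dim (lin_span [set d | exists v w, [/\ P v, P w & d = v - w]]).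

(* [j.+1 = i] and not [j = i.-1]: there is no (-1)-face. *)
Definition minimal_face V (v : V) (F : set V) : Prop :=
  [/\ face (unit_ball V) F, F v &
      forall G, face (unit_ball V) G -> G v ->
        (polyhedron_dim G).+1 <> polyhedron_dim F].

Definition associated_tuple V (v : V) (F : set V) (r : nat) (w : r.-tuple V)
    (eps : R) (mu : r.-tuple R) : Prop :=
  let s := \sum_(j < r) tnth mu j *: tnth w j in
  [/\ F (v + s), F (v - s) & `|s| < eps].

Definition diametric_points V (x : V) (eps : R) (u v : V) : Prop :=
  [/\ (ball x eps `&` unit_ball V) u, (ball x eps `&` unit_ball V) v &
      u + v = 2 *: x].

End Geometry.

Section Operators.
Context {R : realType} {X Y : finBanachType R}.
Implicit Type T : 'Hom(X, Y).

Definition opnorm T : R := sup [set `|T x| | x in unit_sphere X].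

Definition extreme_contraction T : Prop :=
  extreme_points [set A : 'Hom(X, Y) | opnorm A <= 1] T.

Definition norm_attainment T : set X :=
  [set x | unit_sphere X x /\ `|T x| = opnorm T].

(* Finite linearly independent sets are represented by free sequences, up to  *)
(* the order of their elements.                                               *)
Definition extremal_family T (S : seq X) : Prop :=
  free S /\ forall x, x \in S ->
    [/\ norm_attainment T x, extreme_points (unit_ball X) x &
        extreme_points (unit_ball Y) (T x)].

Definition maximal_extremal_family T (S : seq X) : Prop :=
  extremal_family T S /\
  forall S', extremal_family T S' -> {subset S <= S'} -> {subset S' <= S}.

Lemma maximal_extremal_family_exists T : exists S, maximal_extremal_family T S.
Proof.
pose p k := `[<exists S, extremal_family T S /\ size S = k>].
have exp : exists k, p k.
  exists 0%N; apply/asboolP; exists [::]; split=> //; split=> //.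
  exact: nil_free.
have pub k : p k -> (k <= \dim {:X})%N.
  move=> /asboolP[S [[fS _] <-]]; rewrite -(eqP fS); apply: dimvS; exact: subvf.
case: (ex_maxnP exp pub) => k /asboolP[S [ES dS]] kmax.
exists S; split=> // S' ES' SS'.
have sS' : (size S' <= size S)%N.
  by rewrite dS; apply: kmax; apply/asboolP; exists S'.
by have [_ eqS] := uniq_min_size (free_uniq ES.1) SS' sS' => x; rewrite eqS.
Qed.

Lemma maximal_extremal_family_span T (S S' : seq X) :
  maximal_extremal_family T S -> extremal_family T S' -> (<<S'>> <= <<S>>)%VS.
Proof.
move=> [[fS PS] mS] [_ PS']; apply/span_subvP => x xS'.
apply: contraT => xS; have ES : extremal_family T (x :: S).
  split; first by rewrite free_cons xS.
  by move=> t; rewrite inE => /predU1P[->|/PS //]; exact: PS'.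
have /(_ x) := mS _ ES (@mem_behead _ (x :: S)).
by rewrite mem_head => /(_ isT) /memv_span; rewrite (negbTE xS).
Qed.

Definition extremal_number T : nat :=
  xget 0%N [set k | exists S, maximal_extremal_family T S /\ size S = k].

Lemma extremal_numberP T (S : seq X) :
  maximal_extremal_family T S -> extremal_number T = size S.
Proof.
move=> mS; rewrite /extremal_number; case: xgetP => [k _ [S' [mS' <-]]|noS].
  rewrite -(eqP mS.1.1) -(eqP mS'.1.1); congr (\dim _).
  apply: subv_anti; apply/andP; split.
    exact: (maximal_extremal_family_span mS mS'.1).
  exact: (maximal_extremal_family_span mS' mS.1).
by have := noS (size S); case; exists S.
Qed.

(* The set S is [x :: z]. The clause "for any associated tuple [mu]" governs  *)
(* the choice of the vertex [a1 x + sum_i a_i z_i], which may depend on [mu]: *)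
(* a vertex serving all tuples at once need not exist. For instance, the      *)
(* identity, from the space whose unit ball is the truncated octahedron with  *)
(* vertices the permutations of (0, +-1/2, +-1), to l_oo^3, is an extreme     *)
(* contraction of extremal number 0, but the directions of any two facets of  *)
(* the cube have a common nonzero vector, so that no vertex works for u = v.  *)
(* The proviso "[a1 s <> 0] whenever [u = v]" restricts both the tuple, in a  *)
(* hypothesis, and the coefficient [a1] of the vertex, in the conclusion.     *)
Definition star_pair T (x : X) (y : Y) (m : nat) (z : m.-tuple X) : Prop :=
  [/\ opnorm T = 1, unit_sphere X x /\ unit_sphere Y y, \dim {:X} = m.+1,
      free (x :: z) /\ (forall i, unit_sphere X (tnth z i)) &
  exists (F : set Y) (r : nat) (w : r.-tuple Y),
  [/\ minimal_face y F, uniq w,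
      extreme_points (unit_ball Y) `&` F = [set` w] &
  forall (eps : R) (u v : 'I_m -> Y), 0 < eps ->
    (forall i, diametric_points (T (tnth z i)) eps (u i) (v i)) ->
  forall mu : r.-tuple R, associated_tuple y F w eps mu ->
  let s := \sum_(j < r) tnth mu j *: tnth w j in
    (u = v -> s <> 0) ->
  exists (a1 : R) (a : 'I_m -> R),
  [/\ extreme_points (unit_ball X) (a1 *: x + \sum_(i < m) a i *: tnth z i),
      (u = v -> a1 *: s <> 0) &
      (1 < `|a1 *: y + \sum_(i < m) a i *: u i + a1 *: s|) \/
      (1 < `|a1 *: y + \sum_(i < m) a i *: v i - a1 *: s|)]]].

End Operators.

(* Main.v *)
Require Import Defs.
From mathcomp Require Import all_boot all_order all_algebra.
From mathcomp Require Import all_classical all_reals all_analysis.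
From mathcomp Require Import ring lra.
Import Order.TTheory GRing.Theory Num.Theory.
Import numFieldNormedType.Exports VectorInternalTheory.
Local Open Scope classical_set_scope.
Local Open Scope ring_scope.

Set Implicit Arguments.
Unset Strict Implicit.
Unset Printing Implicit Defensive.

(** Write B_X for the unit ball of X. Since B_X is the convex hull of its
    finitely many extreme points, a linear map is a contraction as soon as it
    has norm at most 1 at these vertices; and T is an extreme contraction iff
    A = 0 is the only perturbation for which T + A and T - A are both
    contractions ([extreme_contractionP]).

    If the extremal number is the dimension, such an A vanishes on a basis of
    points x with T x extreme in B_Y, because T x + A x and T x - A x lie in
    B_Y. If (v, T v) is a star pair with respect to a basis v :: z, then A
    supplies the data that the star condition quantifies over: the points
    T z_i + A z_i and T z_i - A z_i are diametric, and A v is a combination of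
    the vertices of the minimal face of T v, because T v + A v and T v - A v
    cannot leave a face that contains T v ([face_direction_span]). The vertex
    given by the star condition is one where T + A or T - A has norm greater
    than 1, so A = 0 ([star_pair_extreme]).

    Conversely let T be extreme. The vertices where T attains its norm span X,
    since otherwise a small nonzero map that vanishes on them could be added to
    and subtracted from T ([norm_attaining_vertices_span]). If T mapped all of
    them to extreme points, the extremal number would be the dimension; so when
    it is smaller some such vertex v has T v not extreme. Any basis v :: z of
    unit vectors then works: diametric points and an associated tuple prescribe the
    values of a map A on this basis, and the vertex asked for is one where T + A or T - A exceeds norm 1
    ([extreme_contraction_star_pair]).

    What remains is convex geometry in finite dimension: the unit ball is
    compact ([unit_ball_compact]), it is the convex hull of its vertices
    ([unit_ball_hull]), and it is an intersection of finitely many half-spaces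
    ([unit_ball_polyhedron]), so that minimal faces exist. The last two rest on
    the elimination argument of [weighted_cone_halfspaces]. *)

(** * Norms, compactness and continuity in finite dimension *)

Section Topology.
Context {R : realType} {V : finBanachType R}.

Lemma lipschitz_linear_continuous (U W : normedModType R) (f : {linear U -> W})
    (M : R) : (forall x, `|f x| <= M * `|x|) -> continuous f.
Proof.
move=> fM; apply/bounded_linear_continuous/linear_boundedP; near=> r => x.
by rewrite (le_trans (fM x))// ler_wpM2r//; near: r; exact: nbhs_pinfty_ge.
Unshelve. all: by end_near. Qed.

Lemma rV_linear_bounded (n : nat) (W : normedModType R)
    (f : {linear 'rV[R]_n -> W}) :
  exists2 M : R, 0 <= M & forall u, `|f u| <= M * `|u|.
Proof.
exists (\sum_i `|f (delta_mx ord0 i)|) => [|u]; first exact: sumr_ge0.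
rewrite {1}(row_sum_delta u) linear_sum (le_trans (ler_norm_sum _ _ _))//.
rewrite mulr_suml; apply: ler_sum => i _; rewrite linearZ normrZ mulrC ler_wpM2l//.
rewrite [leRHS]/Num.norm/= mx_normrE.
by apply/bigmax_geP; right; exists (ord0, i).
Qed.

Lemma r2v_continuous : continuous (r2v : 'rV[R]_(dim V) -> V).
Proof.
have [M _ rM] := rV_linear_bounded (r2v : {linear 'rV[R]_(dim V) -> V}).
exact: lipschitz_linear_continuous rM.
Qed.

(** The norm attains a minimum over the coordinate vectors of sup norm 1, and
    this minimum is not 0: the two norms are equivalent. *)
Lemma v2r_bounded : exists2 M : R, 0 < M & forall x : V, `|v2r x| <= M * `|x|.
Proof.
pose S := [set u : 'rV[R]_(dim V) | `|u| = 1].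
have cn : continuous (fun u : 'rV[R]_(dim V) => `|u|) by exact: norm_continuous.
have cS : compact S.
  apply: bounded_closed_compact.
    by exists 1; split=> // y y1 u /= ->; exact: ltW.
  apply: (@preimage_closed _ _ (fun u : 'rV[R]_(dim V) => `|u|) [set 1]);
    last exact: closed_eq.
  by move=> u _; exact: cn.
have [S0|S0] := pselect (S !=set0); last first.
  exists 1 => // x; rewrite mul1r; suff -> : v2r x = 0 by rewrite normr0.
  apply: contrapT => /eqP x0; apply: S0; exists (`|v2r x|^-1 *: v2r x).
  by rewrite /S/= normrZ normfV normr_id mulVf ?normr_eq0.
have [|c] := @compact_EVT_min _ R
    (fun u : 'rV[R]_(dim V) => `|r2v u : V|) S S0 cS.
  apply: continuous_subspaceT => u.
  by apply: (continuous_comp (@r2v_continuous u)); exact: norm_continuous.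
rewrite inE /S/= => c1 minc.
have m0 : 0 < `|r2v c : V|.
  rewrite normr_gt0; apply/eqP => /(congr1 v2r); rewrite r2vK linear0 => c0.
  by move: c1; rewrite c0 normr0 => /esym/eqP; rewrite oner_eq0.
exists `|r2v c : V|^-1; first by rewrite invr_gt0.
move=> x; have [->|x0] := eqVneq (v2r x) 0.
  by rewrite normr0 mulr_ge0 ?invr_ge0.
have n0 : 0 < `|v2r x| by rewrite normr_gt0.
have : `|r2v c : V| <= `|r2v (`|v2r x|^-1 *: v2r x) : V|.
  by apply: minc; rewrite inE /S/= normrZ normfV normr_id mulVf ?normr_eq0.
rewrite linearZ/= v2rK normrZ normfV normr_id ler_pdivlMl// => h.
by rewrite ler_pdivlMl// mulrC.
Qed.

(** The ball is the continuous image of a closed bounded set of coordinate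
    vectors. *)
Lemma unit_ball_compact : compact (unit_ball V).
Proof.
have [M M0 vM] := v2r_bounded.
have -> : unit_ball V = r2v @` [set u : 'rV[R]_(dim V) | `|r2v u : V| <= 1].
  apply/seteqP; split=> [x x1|_ [u u1 <-] //].
  by exists (v2r x); rewrite /= v2rK.
apply: continuous_compact.
  by apply: continuous_subspaceT; exact: r2v_continuous.
apply: bounded_closed_compact.
  exists M; split; first exact: num_real.
  move=> y My u /= u1; apply/ltW/(le_lt_trans _ My).
  by have := vM (r2v u); rewrite r2vK => /le_trans; apply; rewrite ler_piMr// ltW.
apply: (@preimage_closed _ _ (fun u : 'rV[R]_(dim V) => `|r2v u : V|)
    [set x | x <= 1]).
  move=> u _.
  by apply: (continuous_comp (@r2v_continuous u)); exact: norm_continuous.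
exact: closed_le.
Qed.

Lemma linear_functional_continuous (f : 'Hom(V, R^o)) : continuous (f : V -> R).
Proof.
have [M M0 vM] := v2r_bounded.
have [N N0 fN] := rV_linear_bounded (f \o r2v : {linear 'rV[R]_(dim V) -> R^o}).
apply: (@lipschitz_linear_continuous V R^o f (N * M)) => x.
have := fN (v2r x); rewrite /= v2rK => /le_trans; apply.
by rewrite -mulrA ler_wpM2l.
Qed.

End Topology.

(** * Finitely generated cones *)

Section LinearForms.
Context {R : realType} {V : vectType R}.
Implicit Types f g : 'Hom(V, R^o).

Lemma formD f u v : f (u + v) = f u + f v :> R. Proof. exact: linearD. Qed.

Lemma formB f u v : f (u - v) = f u - f v :> R. Proof. exact: linearB. Qed.

Lemma formZ f a u : f (a *: u) = a * f u :> R. Proof. exact: linearZ. Qed.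

Lemma form_comb f g a b u : (a *: f + b *: g) u = a * f u + b * g u :> R.
Proof. by rewrite add_lfunE !scale_lfunE. Qed.

End LinearForms.

Section Cones.
Context {R : realType} {V : vectType R}.
Implicit Types (s : seq V) (x : V) (t : R).

(** The cone generated by the vectors (e, 1) of V * R, for e in s. Its slice at
    height t = 1 is the convex hull of s; working with the cone lets the
    generators be added one at a time. *)
Fixpoint weighted_cone s x t : Prop :=
  if s is e :: s' then
    exists2 l, 0 <= l & weighted_cone s' (x - l *: e) (t - l)
  else x = 0 /\ t = 0.

Lemma weighted_cone0 s : weighted_cone s 0 0.
Proof. by elim: s => //= e s IH; exists 0; rewrite // scale0r !subr0. Qed.

Lemma weighted_cone_mem s e : e \in s -> weighted_cone s e 1.
Proof.
elim: s => //= a s IH; rewrite inE => /predU1P[->|es].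
  by exists 1; rewrite // scale1r !subrr; exact: weighted_cone0.
by exists 0; rewrite // scale0r !subr0; exact: IH.
Qed.

(** A sublinear functional bounded by c on the generators is bounded by c on
    their convex hull. The norm, the norm of an operator and linear functionals
    are the instances of interest. *)
Lemma weighted_cone_le (phi : V -> R) (c : R) s x t :
    phi 0 <= 0 -> (forall u v, phi (u + v) <= phi u + phi v) ->
    (forall l u, 0 <= l -> phi (l *: u) <= l * phi u) ->
    (forall e, e \in s -> phi e <= c) ->
  weighted_cone s x t -> phi x <= c * t.
Proof.
move=> phi0 phiD phiZ; elim: s x t => /= [|e s IH] x t sc.
  by move=> [-> ->]; rewrite mulr0.
move=> [l l0 /IH xs]; have {xs} : phi (x - l *: e) <= c * (t - l).
  by apply: xs => a as_; apply: sc; rewrite inE as_ orbT.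
move=> xs; have := phiD (x - l *: e) (l *: e); rewrite subrK => /le_trans; apply.
have le : phi (l *: e) <= l * c.
  by rewrite (le_trans (phiZ _ _ l0))// ler_wpM2l// sc// mem_head.
lra.
Qed.

Lemma weighted_cone_linear_le (f : 'Hom(V, R^o)) (c : R) s x t :
  (forall e, e \in s -> f e <= c) -> weighted_cone s x t -> f x <= c * t.
Proof.
apply: weighted_cone_le => [|u v|l u _]; first by rewrite linear0.
  by rewrite formD.
by rewrite formZ.
Qed.

(** A convex combination that reaches the upper bound c of f only uses
    generators at which f is equal to c, since each of the other ones would make
    it strictly smaller. *)
Lemma weighted_cone_span (f : 'Hom(V, R^o)) (c : R) s x t :
    (forall e, e \in s -> f e <= c) -> weighted_cone s x t -> f x = c * t ->
  x \in <<[seq e <- s | f e == c]>>%VS.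
Proof.
elim: s x t => /= [|e s IH] x t sc; first by move=> [-> _] _; rewrite mem0v.
move=> [l l0 xs] fx.
have sc' a : a \in s -> f a <= c by move=> as_; apply: sc; rewrite inE as_ orbT.
have := weighted_cone_linear_le sc' xs; rewrite formB formZ fx => fxl.
have fe : f e <= c by apply: sc; rewrite mem_head.
have lfe : l * f e = l * c.
  apply/eqP; rewrite eq_le ler_wpM2l//=.
  lra.
have xl : x - l *: e \in <<[seq e <- s | f e == c]>>%VS.
  by apply: IH xs _ => //; rewrite formB formZ fx lfe mulrBr (mulrC l).
have sub : (<<[seq e <- s | f e == c]>> <=
            <<if f e == c then e :: [seq e <- s | f e == c]
              else [seq e <- s | f e == c]>>)%VS.
  by case: ifP => // _; apply: sub_span => a; rewrite inE orbC => ->.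
rewrite -(subrK (l *: e) x) rpredD//; first exact: subvP sub _ xl.
have [->|l1] := eqVneq l 0; first by rewrite scale0r mem0v.
case: ifP => [_|/negP[]]; last by apply/eqP; exact: mulfI l1 _ _ lfe.
by rewrite rpredZ// memv_span// mem_head.
Qed.

Let lin_form (h : 'Hom(V, R^o) * R) x t : R := h.1 x + h.2 * t.

(** Keeping track of where the maximum is attained is what lets the elimination
    below compare this maximum with the upper bounds one by one. *)
Lemma finite_max0 (s : seq R) :
  exists l, [/\ 0 <= l, (forall a, a \in s -> a <= l) & l = 0 \/ l \in s].
Proof.
elim: s => [|a s [l [l0 sl lE]]]; first by exists 0; split=> //; left.
have [al|la] := leP a l.
  exists l; split=> // [b|]; first by rewrite inE => /predU1P[->|/sl].
  by case: lE => [->|ls]; [left|right; rewrite inE ls orbT].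
exists a; split=> [|b|]; first exact: le_trans (ltW la).
  by rewrite inE => /predU1P[->//|/sl bl]; rewrite (le_trans bl)// ltW.
by right; rewrite mem_head.
Qed.

(** A finitely generated cone is an intersection of finitely many half-spaces
    (Weyl), by Fourier-Motzkin elimination. Adding a generator e amounts to
    asking for l >= 0 such that (x, t) - l (e, 1) satisfies the old
    inequalities. Each of these bounds l from below, or from above, or does not
    involve l, according to the sign of its value p at (e, 1). Such an l exists
    iff the inequalities free of l hold and each lower bound, 0 included, is at
    most each upper bound: again finitely many linear inequalities in (x, t). *)
Lemma weighted_cone_halfspaces s : exists hs : seq ('Hom(V, R^o) * R),
  forall x t, weighted_cone s x t <->
    (forall h, h \in hs -> h.1 x + h.2 * t <= 0).
Proof.
elim: s => [|e s [hs hsP]].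
  pose b := vbasis {:V}.
  pose c i : 'Hom(V, R^o) := linfun (coord b i : V -> R^o).
  exists ([:: (0, 1); (0, -1)] ++ [seq (c i, 0) | i : 'I_(\dim {:V})] ++
          [seq (- c i, 0) | i : 'I_(\dim {:V})]) => x t; split=> [[-> ->] h _|H].
    by rewrite linear0 mulr0 addr0.
  split.
    rewrite (coord_vbasis (memvf x)) big1// => i _.
    have ci0 : coord b i x <= 0.
      have := H (c i, 0); rewrite mul0r addr0 lfunE; apply.
      by rewrite !mem_cat; apply/or3P/Or32/mapP; exists i; rewrite ?mem_enum.
    have ci1 : 0 <= coord b i x.
      have := H (- c i, 0); rewrite mul0r addr0 opp_lfunE lfunE oppr_le0; apply.
      by rewrite !mem_cat; apply/or3P/Or33/mapP; exists i; rewrite ?mem_enum.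
    have -> : coord b i x = 0 by apply/eqP; rewrite eq_le ci0 ci1.
    by rewrite scale0r.
  have t0 : t <= 0.
    have := H (0, 1); rewrite zero_lfunE add0r mul1r; apply.
    by rewrite !mem_cat mem_head.
  have t1 : 0 <= t.
    have := H (0, -1); rewrite zero_lfunE add0r mulN1r oppr_le0; apply.
    by rewrite !mem_cat !inE eqxx orbT.
  by apply/eqP; rewrite eq_le t0 t1.
pose p h := lin_form h e 1.
have lin_formB h x t l :
    lin_form h (x - l *: e) (t - l) = lin_form h x t - l * p h.
  rewrite /p /lin_form formB formZ; ring.
(* The lower bound h on l compared with the upper bound k, after multiplication
   by the positive number - p h * p k. *)
pose comb (h k : 'Hom(V, R^o) * R) : 'Hom(V, R^o) * R :=
  (- p k *: h.1 + p h *: k.1, - p k * h.2 + p h * k.2).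
have combE h k x t :
    lin_form (comb h k) x t = - p k * lin_form h x t + p h * lin_form k x t.
  rewrite /lin_form/= form_comb; ring.
exists ([seq h <- hs | p h <= 0] ++
  [seq comb h k | h <- [seq h <- hs | 0 < p h], k <- [seq k <- hs | p k < 0]]).
move=> x t; split=> [[l l0 /hsP xs] h|H].
  have {}xs k : k \in hs -> lin_form k x t <= l * p k.
    by move=> /xs; rewrite -/(lin_form _ _ _) lin_formB subr_le0.
  rewrite mem_cat mem_filter => /orP[/andP[ph /xs]|].
    by move=> /le_trans; apply; rewrite mulr_ge0_le0.
  case/allpairsP => -[h1 k] /= [].
  rewrite !mem_filter => /andP[ph hh] /andP[pk kk] ->.
  rewrite -/(lin_form (comb h1 k) x t) combE.
  have := xs _ hh; have := xs _ kk; nra.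
(* The least admissible l: the largest lower bound, 0 included. *)
have [l [l0 ll lE]] := finite_max0
  [seq lin_form h x t / p h | h <- [seq h <- hs | 0 < p h]].
exists l => //; apply/hsP => h hh.
rewrite -/(lin_form h _ _) lin_formB subr_le0.
have H0 k : k \in hs -> p k <= 0 -> lin_form k x t <= 0.
  by move=> kk pk; apply: H; rewrite mem_cat mem_filter pk kk.
have [ph|ph|ph] := ltgtP (p h) 0; last by rewrite ph mulr0 H0 ?ph.
  case: lE => [->|/mapP[k]]; first by rewrite mul0r H0// ltW.
  rewrite mem_filter => /andP[pk kk] ->.
  have : lin_form (comb k h) x t <= 0.
    apply: H; rewrite mem_cat; apply/orP; right; apply/allpairsP.
    by exists (k, h); rewrite !mem_filter/= pk ph kk hh.
  rewrite combE mulrAC ler_pdivlMr//; lra.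
rewrite -ler_pdivrMr// ll//; apply/mapP; exists h => //.
by rewrite mem_filter ph.
Qed.

End Cones.

(** * Extreme points that maximise a linear functional *)

Section ExtremeSubsets.
Context {R : realType}.

(** When A and K are convex these are the faces of convex analysis. They need
    not be cut out by a supporting hyperplane, and this is what makes the
    relation transitive. *)
Definition extreme_subset (V : lmodType R) (A K : set V) : Prop :=
  K `<=` A /\ forall (u v : V) (t : R), A u -> A v -> 0 < t < 1 ->
    K (t *: u + (1 - t) *: v) -> K u /\ K v.

Lemma extreme_subset_trans (V : lmodType R) (A K L : set V) :
  extreme_subset A K -> extreme_subset K L -> extreme_subset A L.
Proof.
move=> [KA AK] [LK KL]; split=> [x /LK/KA //|u v t Au Av t01 Luv].
by have [Ku Kv] := AK u v t Au Av t01 (LK _ Luv); exact: KL Ku Kv t01 Luv.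
Qed.

Context {V : finBanachType R}.
Implicit Types (f : 'Hom(V, R^o)) (A K : set V).

Lemma argmax_extreme_subset f A : A !=set0 -> compact A ->
  let K := [set x | A x /\ forall y, A y -> f y <= f x] in
  [/\ K !=set0, compact K & extreme_subset A K].
Proof.
move=> A0 cA K.
have [|c] := @compact_EVT_max _ R (f : V -> R) A A0 cA.
  by apply: continuous_subspaceT; exact: linear_functional_continuous.
rewrite inE => Ac cmax; have Kc : K c.
  by split=> // y Ay; apply: cmax; rewrite inE.
split; first by exists c.
  have -> : K = A `&` (f : V -> R) @^-1` [set r | f c <= r].
    apply/seteqP; split=> x [Ax fx]; split=> //; first exact: fx.
    by move=> y Ay; apply: le_trans fx; exact: Kc.2.
  apply: compact_closedI => //; apply: preimage_closed; last exact: closed_ge.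
  by move=> x _; exact: linear_functional_continuous.
split=> [x []//|u v t Au Av /andP[t0 t1] [_ muv]].
have := muv _ Ac; rewrite formD !formZ => fc.
have fu := Kc.2 _ Au; have fv := Kc.2 _ Av.
split; split=> // y Ay; apply: le_trans (Kc.2 _ Ay) _; nra.
Qed.

(** Each functional becomes constant after restriction to its maximisers, which
    form a compact extreme subset. *)
Lemma extreme_subset_constant (fs : seq 'Hom(V, R^o)) A :
  A !=set0 -> compact A -> exists K,
    [/\ K !=set0, extreme_subset A K &
        forall f x y, f \in fs -> K x -> K y -> f x = f y].
Proof.
elim: fs A => [|f fs IH] A A0 cA; first by exists A; split=> //; split=> [//|].
have [] := argmax_extreme_subset f A0 cA.
set L := mkset _ => L0 cL AL; have [K [K0 LK Kc]] := IH L L0 cL.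
exists K; split=> //; first exact: extreme_subset_trans LK.
move=> g x y; rewrite inE => /predU1P[->|gfs]; last exact: Kc.
move=> /LK.1[Ax xmax] /LK.1[Ay ymax].
by apply/eqP; rewrite eq_le ymax// xmax.
Qed.

(** Maximise f over A, then restrict to a subset on which each coordinate is
    constant, obtained by maximising the coordinates one after the other. What
    is left is a single point, and an extreme subset with one point is an
    extreme point. *)
Lemma max_extreme_point f A : A !=set0 -> compact A ->
  exists2 e, extreme_points A e & forall x, A x -> f x <= f e.
Proof.
move=> A0 cA; have [] := argmax_extreme_subset f A0 cA.
set L := mkset _ => L0 cL AL.
pose b := vbasis {:V}.
pose c i : 'Hom(V, R^o) := linfun (coord b i : V -> R^o).
have [K [[e Ke] LK Kc]] :=
  extreme_subset_constant [seq c i | i : 'I_(\dim {:V})] L0 cL.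
have Ke1 x : K x -> x = e.
  move=> Kx; rewrite (coord_vbasis (memvf x)) (coord_vbasis (memvf e)).
  apply: eq_bigr => i _; congr (_ *: _).
  by have := Kc (c i) x e; rewrite map_f ?mem_enum// !lfunE; exact.
have AK := extreme_subset_trans AL LK.
exists e; last by move=> x Ax; exact: (LK.1 _ Ke).2.
split; first exact: AK.1.
move=> u v t Au Av t01 eE; have := AK.2 _ _ _ Au Av t01.
by rewrite -eE => /(_ Ke)[/Ke1 -> /Ke1 ->].
Qed.

End ExtremeSubsets.

(** * Extreme points and midpoints *)

Section Midpoints.
Context {R : realType} {V : lmodType R}.
Implicit Types (C : set V) (x a : V).

Lemma extreme_points_midpoint C x a :
  extreme_points C x -> C (x + a) -> C (x - a) -> a = 0.
Proof.
move=> [_ ext] Cp Cm.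
have t01 : 0 < (2^-1 : R) < 1 by apply/andP; split; lra.
have [] := ext _ _ _ Cp Cm t01.
  have -> : 1 - 2^-1 = 2^-1 :> R by lra.
  rewrite -scalerDr addrACA subrr addr0 -mulr2n -(@scaler_nat R V 2 x) scalerA.
  by rewrite mulVf ?scale1r// pnatr_eq0.
by move=> /eqP; rewrite -subr_eq0 addrC addKr => /eqP.
Qed.

(** For a point inside a segment from u to v, the shorter of the two pieces,
    m *: (u - v), can be taken on both sides of the point by convexity. *)
Lemma midpoint_extreme_points C x :
    (forall u v t, C u -> C v -> 0 <= t <= 1 -> C (t *: u + (1 - t) *: v)) ->
    C x -> (forall a, C (x + a) -> C (x - a) -> a = 0) ->
  extreme_points C x.
Proof.
move=> convC Cx midC; split=> // u v t Cu Cv /andP[t0 t1] xE.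
pose m := Num.min t (1 - t); pose a := m *: (u - v).
have m0 : 0 < m by rewrite lt_min t0 subr_gt0.
have uE : u = x + (1 - t) *: (u - v).
  by rewrite xE scalerBr addrA addrAC addrK -scalerDl addrC subrK scale1r.
have vE : v = x - t *: (u - v).
  by rewrite xE scalerBr opprB addrC addrA subrK -scalerDl addrC subrK scale1r.
have shift b c : 0 < b -> m <= b -> C (x + b *: c) -> C (x + m *: c).
  move=> b0 mb Cxb; have -> : x + m *: c =
      (m / b) *: (x + b *: c) + (1 - m / b) *: x.
    rewrite scalerDr scalerA divfK ?gt_eqF// addrAC -scalerDl.
    by rewrite (addrC (m / b)) subrK scale1r.
  apply: convC => //; rewrite divr_ge0 ?(ltW m0) ?(ltW b0)//=.
  by rewrite ler_pdivrMr// mul1r.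
have /midC : C (x + a).
  apply: (shift (1 - t)); rewrite ?subr_gt0// -?uE//.
  by rewrite ge_min lexx orbT.
have Cma : C (x - a).
  rewrite /a -scalerN; apply: (shift t) => //; last by rewrite scalerN -vE.
  by rewrite ge_min lexx.
move=> /(_ Cma) /eqP; rewrite scaler_eq0 gt_eqF//= => /eqP uv0.
by rewrite uE {2}vE uv0 !scaler0 subr0 addr0.
Qed.

End Midpoints.

(** * The unit ball of a polyhedral space *)

Section UnitBall.
Context {R : realType} {V : finBanachType R}.

Lemma unit_ball0 : unit_ball V 0.
Proof. by rewrite /unit_ball/= normr0. Qed.

Lemma unit_ball_convex (u v : V) (t : R) : unit_ball V u -> unit_ball V v ->
  0 <= t <= 1 -> unit_ball V (t *: u + (1 - t) *: v).
Proof.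
rewrite /unit_ball/= => u1 v1 /andP[t0 t1].
rewrite (le_trans (ler_normD _ _))// !normrZ !ger0_norm ?subr_ge0//.
have := ler_wpM2l t0 u1; have t1' : 0 <= 1 - t by lra.
by have := ler_wpM2l t1' v1; lra.
Qed.

Section Hull.
Variable s : seq V.
Hypothesis sE : extreme_points (unit_ball V) = [set` s].

Lemma vertex_unit_ball e : e \in s -> unit_ball V e.
Proof. by move=> es; have [] : extreme_points (unit_ball V) e by rewrite sE. Qed.

(** A point of the ball outside the hull violates one of the inequalities that
    define the hull; the functional of this inequality would be maximised over
    the ball at an extreme point, which belongs to the hull. *)
Lemma unit_ball_hull : unit_ball V = [set x | weighted_cone s x 1].
Proof.
apply/seteqP; split=> x /= x1; last first.
  have := @weighted_cone_le R V (Num.norm : V -> R) 1 s x 1.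
  rewrite /unit_ball /= mulr1 normr0; apply=> //.
  - exact: ler_normD.
  - by move=> l u l0; rewrite normrZ ger0_norm.
  - by move=> e; exact: vertex_unit_ball.
have [hs hsP] := weighted_cone_halfspaces s; apply/hsP => h hh.
have [e] := max_extreme_point h.1 (ex_intro _ _ unit_ball0)
  (@unit_ball_compact _ V).
rewrite sE /= => es /(_ _ x1) xe.
have := (hsP _ _).1 (weighted_cone_mem es) h hh.
lra.
Qed.

Lemma unit_ball_polyhedron : polyhedron (unit_ball V).
Proof.
split; [by exists 0; exact: unit_ball0|exact: unit_ball_compact|].
have [hs hsP] := weighted_cone_halfspaces s.
(* At height 1 an inequality with h.1 = 0 says h.2 <= 0, which holds because the
   ball is nonempty; the proper half-spaces are the other ones. *)
exists [seq (h.1, - h.2) | h <- hs & h.1 != 0]; split.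
  by move=> _ /mapP[h + ->]; rewrite mem_filter => /andP[].
rewrite unit_ball_hull; apply/seteqP; split=> x /=.
  move=> /hsP xs _ /mapP[h + ->]; rewrite mem_filter => /andP[_ hh].
  by have := xs h hh; rewrite /closed_halfspace/=; lra.
move=> H; apply/hsP => h hh; have [h0|h0] := eqVneq h.1 0.
  have : weighted_cone s 0 1 by have := unit_ball0; rewrite unit_ball_hull.
  by move=> /(hsP _ _).1 /(_ h hh); rewrite h0 !zero_lfunE.
have := H (h.1, - h.2); rewrite /closed_halfspace/= => Hh.
have : h.1 x <= - h.2 by apply: Hh; apply/mapP; exists h; rewrite ?mem_filter ?h0.
by lra.
Qed.

(** The functional that defines F is maximal at y, so it cannot increase in
    either of the directions a and - a: hence it is constant on the segment,
    which stays in F, and F is the convex hull of the vertices that it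
    contains. *)
Lemma face_direction_span (F : set V) (w : seq V) (y a : V) :
    face (unit_ball V) F -> extreme_points (unit_ball V) `&` F = [set` w] ->
    F y -> unit_ball V (y + a) -> unit_ball V (y - a) ->
  F (y + a) /\ a \in <<w>>%VS.
Proof.
move=> [_ FE] wE Fy Bp Bm.
(* The whole ball is the face cut out by the zero functional. *)
have [f [c [Bf {}FE]]] : exists (f : 'Hom(V, R^o)) (c : R),
    unit_ball V `<=` closed_halfspace f c /\
    F = unit_ball V `&` halfspace_boundary f c.
  case: FE => [->|[f [c [_ Bf ->]]]]; last by exists f, c.
  exists 0, 0; split=> [x _|]; first by rewrite /closed_halfspace/= zero_lfunE.
  apply/seteqP; split=> [x Bx|x []//]; split=> //.
  by rewrite /halfspace_boundary/= zero_lfunE.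
have [By fy] : (unit_ball V `&` halfspace_boundary f c) y by rewrite -FE.
rewrite /halfspace_boundary/= in fy.
have fp : f (y + a) = c.
  have := Bf _ Bp; have := Bf _ Bm; rewrite /closed_halfspace/= formB formD fy.
  by move=> ? ?; apply/eqP; rewrite eq_le; apply/andP; split; lra.
split; first by rewrite FE.
have sf e : e \in s -> f e <= c by move=> /vertex_unit_ball/Bf.
have sw : (<<[seq e <- s | f e == c]>> <= <<w>>)%VS.
  apply: sub_span => e; rewrite mem_filter => /andP[/eqP fe es].
  suff : [set` w] e by [].
  rewrite -wE; split; first by rewrite sE.
  by rewrite FE; split=> //; exact: vertex_unit_ball.
have span x : unit_ball V x -> f x = c -> x \in <<w>>%VS.
  rewrite unit_ball_hull /= => xs fx; apply: (subvP sw).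
  by apply: weighted_cone_span xs _ => //; rewrite mulr1.
by rewrite -(addKr y a) rpredD ?rpredN ?span.
Qed.

End Hull.

(** The ball is itself a face that contains y, so that there is a face of least
    dimension among those that contain y. *)
Lemma minimal_face_exists (y : V) :
  polyhedral V -> unit_ball V y -> exists F, minimal_face y F.
Proof.
move=> /finite_seqP[s sE] By.
pose p k := `[<exists F, [/\ face (unit_ball V) F, F y & polyhedron_dim F = k]>].
have exp : exists k, p k.
  exists (polyhedron_dim (unit_ball V)); apply/asboolP; exists (unit_ball V).
  by split=> //; split; [exact: unit_ball_polyhedron sE|left].
case: (ex_minnP exp) => k /asboolP[F [fF Fy dF]] kmin.
exists F; split=> // G fG Gy dG.
have : (k <= polyhedron_dim G)%N by apply: kmin; apply/asboolP; exists G.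
by rewrite -dF -dG ltnn.
Qed.

End UnitBall.

(** * The operator norm *)

Section Operators.
Context {R : realType} {X Y : finBanachType R}.
Hypothesis polyX : polyhedral X.
Implicit Types A T : 'Hom(X, Y).

Lemma norm_operator_hull (s : seq X)
    (sE : extreme_points (unit_ball X) = [set` s]) A (M : R) :
  (forall e, e \in s -> `|A e| <= M) -> forall x, unit_ball X x -> `|A x| <= M.
Proof.
move=> sM x; rewrite (unit_ball_hull sE) /= => xs.
have := @weighted_cone_le R X (fun x => `|A x|) M s x 1; rewrite mulr1; apply=> //.
- by rewrite linear0 normr0.
- by move=> u v; rewrite linearD ler_normD.
- by move=> l u l0; rewrite linearZ/= normrZ ger0_norm.
Qed.

(** The supremum of an unbounded set is only a default value; here the values at
    the vertices give a bound. *)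
Lemma opnorm_has_ubound A : has_ubound [set `|A x| | x in unit_sphere X].
Proof.
have /finite_seqP[s sE] := polyX.
exists (\sum_(e <- s) `|A e|) => _ [x /= x1 <-].
apply: (norm_operator_hull sE _ (x := x)); last by rewrite /unit_ball/= x1.
by move=> e es; rewrite (big_rem e es)/= lerDl sumr_ge0.
Qed.

Lemma le_opnorm A x : `|A x| <= opnorm A * `|x|.
Proof.
have [->|x0] := eqVneq x 0; first by rewrite linear0 !normr0 mulr0.
have nx : 0 < `|x| by rewrite normr_gt0.
have : `|A (`|x|^-1 *: x)| <= opnorm A.
  apply: ub_le_sup; first exact: opnorm_has_ubound.
  exists (`|x|^-1 *: x) => //=.
  by rewrite /unit_sphere/= normrZ normfV normr_id mulVf ?gt_eqF.
by rewrite linearZ/= normrZ normfV normr_id ler_pdivrMl// mulrC.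
Qed.

Lemma opnorm_le A (M : R) :
  0 <= M -> (forall x, unit_sphere X x -> `|A x| <= M) -> opnorm A <= M.
Proof.
move=> M0 AM; have [S0|S0] := pselect (unit_sphere X !=set0); last first.
  rewrite /opnorm (_ : unit_sphere X = set0) ?image_set0 ?sup0//.
  by apply/seteqP; split=> x // x1; apply: S0; exists x.
apply: ge_sup; first exact: image_nonempty.
by move=> _ [x x1 <-]; exact: AM.
Qed.

Lemma opnorm_le1P A :
  opnorm A <= 1 <-> (forall x, unit_ball X x -> `|A x| <= 1).
Proof.
split=> [A1 x x1|A1].
  by rewrite (le_trans (le_opnorm A x))// (le_trans _ x1)// ler_piMl.
by apply: opnorm_le => // x x1; apply: A1; rewrite /unit_ball/= (x1 : _ = _).
Qed.

Lemma extreme_contractionP T : opnorm T <= 1 ->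
  extreme_contraction T <->
  (forall A, opnorm (T + A) <= 1 -> opnorm (T - A) <= 1 -> A = 0).
Proof.
move=> T1; split=> [extT A|midT]; first exact: extreme_points_midpoint extT.
apply: midpoint_extreme_points => //= A B t /opnorm_le1P A1 /opnorm_le1P B1 t01.
apply/opnorm_le1P => x x1; rewrite add_lfunE !scale_lfunE.
by apply: unit_ball_convex => //; [exact: A1|exact: B1].
Qed.

End Operators.

(** * Characterisation of extreme contractions *)

Section ExtremeContractions.
Context {R : realType} {X Y : finBanachType R}.
Hypotheses (polyX : polyhedral X) (polyY : polyhedral Y).
Implicit Types A T : 'Hom(X, Y).

Lemma lfun_eq0_span (S : seq X) A :
  (<<S>> = fullv)%VS -> (forall x, x \in S -> A x = 0) -> A = 0.
Proof.
move=> Sfull AS; apply/lfunP => x; rewrite zero_lfunE; apply/eqP.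
rewrite -memv_ker; have : (<<S>> <= lker A)%VS.
  by apply/span_subvP => a /AS Aa; rewrite memv_ker Aa.
by rewrite Sfull => /subvP; apply; exact: memvf.
Qed.

Lemma extremal_number_le T : (extremal_number T <= \dim {:X})%N.
Proof.
have [S mS] := maximal_extremal_family_exists T.
rewrite (extremal_numberP mS) -(eqP mS.1.1); exact/dimvS/subvf.
Qed.

(** At a point x with T x extreme, T x + A x and T x - A x can both lie in the
    ball of Y only if A x = 0. *)
Lemma full_extremal_number_extreme T : opnorm T = 1 ->
  extremal_number T = \dim {:X} -> extreme_contraction T.
Proof.
move=> T1; have [S mS] := maximal_extremal_family_exists T.
have [[fS ES] _] := mS; rewrite (extremal_numberP mS) => dS.
apply/(extreme_contractionP polyX); first by rewrite T1.
move=> A /(opnorm_le1P polyX) Ap /(opnorm_le1P polyX) Am.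
apply: (@lfun_eq0_span S) => [|x xS].
  by apply/eqP; rewrite eqEdim subvf /= (eqP fS) dS.
have [_ [Bx _] eTx] := ES x xS; apply: extreme_points_midpoint eTx _ _.
  by have := Ap x Bx; rewrite add_lfunE.
by have := Am x Bx; rewrite add_lfunE opp_lfunE.
Qed.

(** A nonzero perturbation A of T, with T + A and T - A contractions, yields
    diametric points and an associated tuple to which the star condition
    applies; the vertex it returns contradicts that both are contractions. *)
Lemma star_pair_extreme T (v : X) (m : nat) (z : m.-tuple X) :
  star_pair T v (T v) z -> extreme_contraction T.
Proof.
move=> [T1 [v1 _] dX [fz z1] [F [r [w [[fF Fy _] _ wE star]]]]].
apply/(extreme_contractionP polyX); first by rewrite T1.
move=> A /(opnorm_le1P polyX) Ap /(opnorm_le1P polyX) Am.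
have {}Ap x : unit_ball X x -> `|T x + A x| <= 1.
  by move=> /Ap; rewrite add_lfunE.
have {}Am x : unit_ball X x -> `|T x - A x| <= 1.
  by move=> /Am; rewrite add_lfunE opp_lfunE.
have Bz i : unit_ball X (tnth z i) by rewrite /unit_ball/= (z1 i : _ = _).
have Bv : unit_ball X v by rewrite /unit_ball/= (v1 : _ = _).
apply: contrapT => A0.
have zfull : (<<v :: z>> = fullv)%VS.
  by apply/eqP; rewrite eqEdim subvf /= (eqP fz) dX /= size_tuple.
have /finite_seqP[sY sYE] := polyY.
have [Fp wA] := face_direction_span sYE fF wE Fy (Ap _ Bv) (Am _ Bv).
have [Fm _] : F (T v - A v) /\ - A v \in <<w>>%VS.
  by apply: (face_direction_span sYE fF wE Fy); rewrite ?opprK;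
    [exact: Am|exact: Ap].
(* Any strict upper bound of the norms of A v and of the A z_i. *)
pose eps : R := 1 + `|A v| + \sum_i `|A (tnth z i)|.
have sum0 : 0 <= \sum_i `|A (tnth z i)| by exact: sumr_ge0.
have eps0 : 0 < eps by rewrite /eps -addrA ltr_pwDl// addr_ge0.
have epsz i : `|A (tnth z i)| < eps.
  have : `|A (tnth z i)| <= \sum_i `|A (tnth z i)|.
    by rewrite (bigD1 i)//= lerDl sumr_ge0.
  by have := normr_ge0 (A v); rewrite /eps; lra.
have epsv : `|A v| < eps by rewrite /eps; lra.
pose mu := [tuple coord w j (A v) | j < r].
have muE : \sum_(j < r) tnth mu j *: tnth w j = A v.
  rewrite [RHS](coord_span wA); apply: eq_bigr => j _.
  by rewrite tnth_mktuple (tnth_nth 0).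
have comb (B : 'Hom(X, Y)) a1 (a : 'I_m -> R) :
    a1 *: T v + \sum_i a i *: (T (tnth z i) + B (tnth z i)) + a1 *: B v =
    (T + B) (a1 *: v + \sum_i a i *: tnth z i).
  rewrite linearD linear_sum linearZ/= add_lfunE scalerDr addrAC; congr (_ + _).
  by apply: eq_bigr => i _; rewrite linearZ/= add_lfunE.
have diam i : diametric_points (T (tnth z i)) eps
    (T (tnth z i) + A (tnth z i)) (T (tnth z i) - A (tnth z i)).
  split; [split; [|exact: Ap]|split; [|exact: Am]|].
  - by rewrite -ball_normE /ball_/= opprD addNKr normrN.
  - by rewrite -ball_normE /ball_/= opprB addrC subrK.
  - by rewrite addrACA subrr addr0 scaler_nat mulr2n.
have [||a1 [a [Be _]]] := star eps (fun i => T (tnth z i) + A (tnth z i))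
  (fun i => T (tnth z i) - A (tnth z i)) eps0 diam mu.
- by split; rewrite muE.
- rewrite muE => uv Av0; apply: A0; apply: (lfun_eq0_span zfull) => x.
  rewrite inE => /predU1P[->//|/tnthP[i ->]].
  have /eqP := congr1 (fun u => u i) uv.
  rewrite -subr_eq0 opprB addrC addrA subrK -mulr2n -scaler_nat.
  by rewrite scaler_eq0 pnatr_eq0/= => /eqP.
rewrite muE => -[|].
  by rewrite comb ltNge add_lfunE (Ap _ Be.1).
rewrite -scalerN; have /= := comb (- A) a1 a.
under eq_bigr do rewrite opp_lfunE.
by rewrite opp_lfunE => ->; rewrite ltNge add_lfunE opp_lfunE (Am _ Be.1).
Qed.

(** The points where f leaves no margin are harmless because g vanishes there,
    and the margins at the finitely many other points have a positive
    minimum. *)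
Lemma small_perturbation (I : eqType) (s : seq I) (f g : I -> R) :
    (forall e, e \in s -> f e <= 1) -> (forall e, 0 <= g e) ->
    (forall e, e \in s -> f e = 1 -> g e = 0) ->
  exists2 d, 0 < d & forall e, e \in s -> f e + d * g e <= 1.
Proof.
move=> + g0; elim: s => [|e s IH] f1 fg; first by exists 1.
have [a es|a es|d d0 ds] := IH.
- by apply: f1; rewrite inE es orbT.
- by apply: fg; rewrite inE es orbT.
have [fe|fe] := eqVneq (f e) 1.
  exists d => // a; rewrite inE => /predU1P[->|/ds//].
  by rewrite fg ?mem_head// mulr0 addr0 f1 ?mem_head.
have fe1 : f e < 1 by rewrite lt_neqAle fe f1 ?mem_head.
have ge0 := g0 e; have ge1 : 0 < 1 + g e by lra.
pose d' := Num.min d ((1 - f e) / (1 + g e)).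
have d'0 : 0 < d' by rewrite lt_min d0 divr_gt0 ?subr_gt0.
exists d' => // a; rewrite inE => /predU1P[->|/ds]; last first.
  apply: le_trans; rewrite lerD2l ler_wpM2r// ge_min lexx //.
have : d' <= (1 - f e) / (1 + g e) by rewrite ge_min lexx orbT.
rewrite ler_pdivlMr//; lra.
Qed.

(** If the span is not the whole space, some A <> 0 vanishes on it. A small
    multiple of A keeps T + A and T - A contractive: nothing changes at the
    vertices where T attains its norm, and there is room at the others. *)
Lemma norm_attaining_vertices_span (s : seq X) T (y : Y) :
    extreme_points (unit_ball X) = [set` s] -> y != 0 ->
    opnorm T = 1 -> extreme_contraction T ->
  (<<[seq e <- s | `|T e| == 1%R]>> = fullv)%VS.
Proof.
move=> sE y0 T1 /(extreme_contractionP polyX) extT.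
have {}extT := (extT (eq_ind_r (fun r => r <= 1) (lexx 1) T1)).
have sB e : e \in s -> unit_ball X e by exact: vertex_unit_ball.
have Ts e : e \in s -> `|T e| <= 1.
  by move=> /sB; apply: (opnorm_le1P polyX T).1; rewrite T1.
set s1 := [seq e <- s | _]; apply/eqP; rewrite eqEsubv subvf/=.
apply: contrapT => /negP /subvPn[x _ xs1].
pose b := vbasis (span s1).
have fb : free (x :: b).
  by rewrite free_cons (span_basis (vbasisP _)) xs1 (basis_free (vbasisP _)).
have [A0 /(_ fb)] := linear_of_free (x :: b) (y :: nseq (size b) 0).
rewrite /= size_nseq => /(_ erefl)[A0x A0b].
pose A : 'Hom(X, Y) := linfun A0.
have Ax : A x = y by rewrite lfunE.
have As1 e : e \in s1 -> A e = 0.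
  move=> es1; apply/eqP; rewrite -memv_ker.
  have : (<<b>> <= lker A)%VS.
    apply/span_subvP => a ab; rewrite memv_ker lfunE/=.
    have : A0 a \in map A0 b by rewrite map_f.
    by rewrite A0b mem_nseq => /andP[_].
  by rewrite (span_basis (vbasisP _)) => /subvP; apply; exact: memv_span.
have [d d0 ds] : exists2 d : R, 0 < d &
    forall e, e \in s -> `|T e| + d * `|A e| <= 1.
  apply: small_perturbation => [e es|//|e]; first by rewrite Ts.
  by move=> es /eqP Te1; rewrite As1 ?normr0// mem_filter Te1.
have dA0 : d *: A = 0.
  apply: extT; apply/(opnorm_le1P polyX);
    apply: norm_operator_hull sE _ _ _ => e es.
    rewrite add_lfunE scale_lfunE (le_trans (ler_normD _ _))// normrZ gtr0_norm//.
    exact: ds.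
  rewrite add_lfunE opp_lfunE scale_lfunE (le_trans (ler_normB _ _))//.
  by rewrite normrZ gtr0_norm// ds.
move/eqP: y0; apply; rewrite -Ax; have /eqP := dA0.
by rewrite scaler_eq0 gt_eqF//= => /eqP ->; rewrite zero_lfunE.
Qed.

(** Diametric points u, u' and an associated vector s define A on the basis by
    A v = s and A z_i = (u_i - u'_i) / 2, so that T + A and T - A send z_i to
    u_i and u'_i. The proviso on u = u' says A <> 0, hence one of T + A and
    T - A is not a contraction, and this is detected at a vertex e. *)
Lemma extreme_contraction_star_pair T (v : X) (m : nat) (z : m.-tuple X) :
    extreme_contraction T -> opnorm T = 1 ->
    norm_attainment T v -> basis_of {:X} (v :: z) ->
    (forall i, unit_sphere X (tnth z i)) ->
  star_pair T v (T v) z.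
Proof.
move=> extT T1 [v1 Tv] bz z1; rewrite T1 in Tv.
have fz := basis_free bz; have zfull := span_basis bz.
split=> //; first by rewrite -zfull (eqP fz)/= size_tuple.
have [F mF] : exists F, minimal_face (T v) F.
  by apply: minimal_face_exists => //; rewrite /unit_ball/= Tv.
have /finite_seqP[sY sYE] := polyY.
pose w := undup [seq e <- sY | `[<F e>]].
exists F, (size w), (in_tuple w); split=> //; first exact: undup_uniq.
  apply/seteqP; split=> e /=; rewrite /in_tuple/= mem_undup mem_filter sYE.
    by move=> [/= es Fe]; rewrite es andbT; apply/asboolP.
  by move=> /andP[/asboolP Fe es].
move=> eps u u' eps0 uu' mu _ s s0.
have [A0 /(_ fz)] := linear_of_free (v :: z)
  (s :: [seq 2^-1 *: (u i - u' i) | i : 'I_m]).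
rewrite /= size_map size_enum_ord size_tuple => /(_ erefl)[A0v A0z].
pose A : 'Hom(X, Y) := linfun A0.
have Av : A v = s by rewrite lfunE.
have Az i : A (tnth z i) = 2^-1 *: (u i - u' i).
  rewrite lfunE/= (tnth_nth 0) -(nth_map 0 0) ?size_tuple// A0z.
  by rewrite (nth_map i) ?size_enum_ord// nth_ord_enum.
have Tz i : T (tnth z i) = 2^-1 *: (u i + u' i).
  by have [_ _ ->] := uu' i; rewrite scalerA mulVf ?scale1r// pnatr_eq0.
have Tp i : u i = T (tnth z i) + A (tnth z i).
  rewrite Tz Az -scalerDr addrACA subrr addr0 -mulr2n -(@scaler_nat R Y 2).
  by rewrite scalerA mulVf ?scale1r// pnatr_eq0.
have Tm i : u' i = T (tnth z i) - A (tnth z i).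
  rewrite Tz Az -scalerBr opprB addrC addrA subrK -mulr2n -(@scaler_nat R Y 2).
  by rewrite scalerA mulVf ?scale1r// pnatr_eq0.
have A_neq0 : A <> 0.
  move=> A_eq0; apply: s0; last by rewrite -Av A_eq0 zero_lfunE.
  by apply/funext => i; rewrite Tp Tm A_eq0 zero_lfunE subr0 addr0.
have /finite_seqP[sX sXE] := polyX.
have [e es Te] : exists2 e, e \in sX & (1 < `|(T + A) e|) \/ (1 < `|(T - A) e|).
  apply: contrapT => noe; apply: A_neq0.
  move/(extreme_contractionP polyX): extT; apply; first by rewrite T1.
    apply/(opnorm_le1P polyX); apply: (norm_operator_hull sXE) => e es.
    by rewrite leNgt; apply/negP => Te; apply: noe; exists e => //; left.
  apply/(opnorm_le1P polyX); apply: (norm_operator_hull sXE) => e es.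
  by rewrite leNgt; apply/negP => Te; apply: noe; exists e => //; right.
have [a1 [a eE]] : exists a1 (a : 'I_m -> R),
    e = a1 *: v + \sum_i a i *: tnth z i.
  have := @coord_span _ _ _ [tuple of v :: z] e; rewrite zfull memvf => /(_ isT).
  rewrite big_ord_recl/= => eE; exists (coord [tuple of v :: z] ord0 e).
  exists (fun i => coord [tuple of v :: z] (lift ord0 i) e).
  by rewrite [LHS]eE; congr (_ + _); apply: eq_bigr => i _; rewrite (tnth_nth 0).
have TpE : (T + A) e = a1 *: T v + \sum_i a i *: u i + a1 *: s.
  rewrite eE linearD linear_sum linearZ/= add_lfunE scalerDr Av addrAC.
  by congr (_ + _ + _); apply: eq_bigr => i _; rewrite linearZ/= add_lfunE -Tp.
have TmE : (T - A) e = a1 *: T v + \sum_i a i *: u' i - a1 *: s.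
  rewrite eE linearD linear_sum linearZ/= add_lfunE opp_lfunE scalerBr Av addrAC.
  congr (_ + _ + _); apply: eq_bigr => i _.
  by rewrite linearZ/= add_lfunE opp_lfunE -Tm.
exists a1, a; rewrite -eE -TpE -TmE; split=> //; first by rewrite sXE.
(* Otherwise A vanishes at e, where T + A and T - A then agree with T and have
   norm at most 1. *)
move=> uu s1; have Az0 i : A (tnth z i) = 0 by rewrite Az uu subrr scaler0.
have Ae : A e = 0.
  rewrite eE linearD linear_sum linearZ/= Av s1 add0r big1// => i _.
  by rewrite linearZ/= Az0 scaler0.
have Te1 : `|T e| <= 1.
  by apply: (opnorm_le1P polyX T).1; [rewrite T1|exact: vertex_unit_ball sXE _ es].
move: Te; rewrite !add_lfunE opp_lfunE Ae subr0 addr0.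
by case; rewrite ltNge Te1.
Qed.

(** The remaining vectors are those of a basis of a complement of the line of v,
    normalised. *)
Lemma basis_of_unit_vectors (v : X) : unit_sphere X v ->
  exists (m : nat) (z : m.-tuple X),
    basis_of {:X} (v :: z) /\ (forall i, unit_sphere X (tnth z i)).
Proof.
move=> v1; have v0 : v != 0.
  by apply/eqP => v0; move/eqP: v1; rewrite v0 normr0 eq_sym oner_eq0.
pose U := (<[v]>^C)%VS; pose b := vbasis U.
exists (\dim U), [tuple `|tnth b i|^-1 *: tnth b i | i < \dim U].
have bn i : `|tnth b i| != 0.
  by rewrite normr_eq0 (free_not0 (basis_free (vbasisP U)))// mem_tnth.
split=> [|i]; last first.
  by rewrite tnth_mktuple /unit_sphere/= normrZ normfV normr_id mulVf.
rewrite basisEdim; apply/andP; split; last first.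
  rewrite /= size_map size_enum_ord dimv_compl dim_vline v0 subn1 prednK//.
  by rewrite (leq_trans _ (dimvS (subvf <[v]>%VS)))// dim_vline v0.
rewrite -(addv_complf <[v]>%VS) -/U span_cons addvS//.
rewrite -[X in (X <= _)%VS](span_basis (vbasisP U)).
apply/span_subvP => x /tnthP[i ->].
rewrite -[tnth _ i]scale1r -(mulfV (bn i)) -scalerA rpredZ// memv_span//.
by apply/tnthP; exists i; rewrite tnth_mktuple.
Qed.

End ExtremeContractions.

Theorem theorem2p19 (R : realType) (X Y : finBanachType R) (n : nat)
    (T : 'Hom(X, Y)) (polyX : polyhedral X) (polyY : polyhedral Y)
    (dimX : \dim {:X} = n) (normT : opnorm T = 1) :
  extreme_contraction T <->
  exactly_one
    (extremal_number T = n)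
    ((extremal_number T < n)%N /\
     exists (v : X) (m : nat) (z : m.-tuple X),
       [/\ norm_attainment T v /\ extreme_points (unit_ball X) v,
           basis_of {:X} (v :: z) /\
             (forall x, x \in v :: z -> unit_sphere X x),
           ~ extreme_points (unit_ball Y) (T v) &
           star_pair T v (T v) z]).
Proof.
split=> [extT|]; last first.
  case=> [[Tn _]|[_ [_ [v [m [z [_ _ _ sp]]]]]]]; last exact: star_pair_extreme sp.
  by apply: full_extremal_number_extreme => //; rewrite dimX.
have [Tn|Tn] := eqVneq (extremal_number T) n.
  by left; split=> // -[]; rewrite Tn ltnn.
right; split; first by move=> /eqP; rewrite (negbTE Tn).
have Tlt : (extremal_number T < n)%N.
  by rewrite ltn_neqAle Tn -dimX extremal_number_le.
split=> //.
have [v [Mv ev nTv]] : exists v, [/\ norm_attainment T v,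
    extreme_points (unit_ball X) v & ~ extreme_points (unit_ball Y) (T v)].
  apply: contrapT => nov; move/eqP: Tn; apply.
  have /finite_seqP[s sE] := polyX.
  have [y y0] : exists y : Y, y != 0.
    apply: contrapT => noy; have : opnorm T <= 0; last by rewrite normT ler10.
    apply: opnorm_le => // x _; rewrite normr_le0; apply: contrapT => /negP Tx.
    by apply: noy; exists (T x).
  have [S mS] := maximal_extremal_family_exists T.
  rewrite (extremal_numberP mS) -dimX -(eqP mS.1.1); congr (\dim _).
  apply/eqP; rewrite eqEsubv subvf/=.
  rewrite -(norm_attaining_vertices_span polyX sE y0 normT extT).
  apply/span_subvP => e; rewrite mem_filter => /andP[/eqP Te es].
  have : e \in <<[:: e]>>%VS by rewrite memv_span// mem_head.
  apply/subvP; apply: (maximal_extremal_family_span mS).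
  have ee : extreme_points (unit_ball X) e by rewrite sE.
  have Me : norm_attainment T e.
    split; last by rewrite normT.
    apply/eqP; rewrite eq_le [_ <= 1]ee.1/=.
    by have := le_opnorm polyX T e; rewrite Te normT mul1r.
  split=> [|x].
    by rewrite seq1_free; apply/eqP => e0; move: Te; rewrite e0 linear0 normr0; lra.
  rewrite inE => /eqP ->; split=> //.
  by apply: contrapT => nTe; apply: nov; exists e.
have [m [z [bz z1]]] := basis_of_unit_vectors Mv.1.
exists v, m, z; split=> //; last exact: extreme_contraction_star_pair.
by split=> // x; rewrite inE => /predU1P[->|/tnthP[i ->]]; [exact: Mv.1|].
Qed.
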